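(* There is a family $\mathcal{C}$ of cardinality $\mathfrak{c} = |\mathbb{R}|$ of pairwise non-homeomorphic continua such that $X \times X$ is homeomorphic to $X$ for each $X \in \mathcal{C}$.
   Context: A continuum is a (nonempty) compact connected metrizable topological space. *)

(* Defs.v *)
From HB Require Import structures.
From mathcomp Require Import all_boot all_order all_algebra.
From mathcomp Require Import all_classical all_reals all_analysis.

Set Implicit Arguments.
Unset Strict Implicit.
Unset Printing Implicit Defensive.

Local Open Scope classical_set_scope.

Definition homeomorphic (T U : topologicalType) : Prop :=
  exists (f : T -> U) (g : U -> T),
    [/\ cancel f g, cancel g f, continuous f & continuous g].

(* [metricType R], unlike [pseudoMetricType R], has a distance that separates
   points. *)
Definition metrizable (R : realType) (T : topologicalType) : Prop :=
  exists M : metricType R, homeomorphic T M.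

Definition continuum (R : realType) (T : topologicalType) : Prop :=
  [/\ [set: T] !=set0, compact [set: T], connected [set: T]
    & metrizable R T].

(* Main.v *)
(* Let X_P be the Pontryagin dual of a countable direct sum of copies of
   Z[1/P], for a set P of primes (a countable power of a solenoid).  It is a
   compact connected metrizable group isomorphic to its square, and P can be
   read off its topology: p belongs to P iff every continuous map from X_P to
   R/Z is homotopic to p times another one.

   - On a compact connected group G every continuous f : G -> R/Z satisfies
     f (x + y) = f x + f y - f 0 up to a map that lifts to the reals, so
     f (p x) is homotopic to p f(x).  If p is in P, multiplication by p is a
     homeomorphism of X_P, hence every map is divisible by p.
   - If p is not in P, X_P has an element of order p on which some coordinate
     character does not vanish, and such a character is not divisible by p. *)
Require Import Defs.
From HB Require Import structures.
From mathcomp Require Import all_boot all_order all_algebra.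
From mathcomp Require Import generic_quotient ring_quotient lra zify.
From mathcomp Require Import all_classical all_reals all_analysis.

Set Implicit Arguments.
Unset Strict Implicit.
Unset Printing Implicit Defensive.

Import Order.TTheory GRing.Theory Num.Theory.
Import numFieldNormedType.Exports.

Local Open Scope classical_set_scope.
Local Open Scope ring_scope.

(** * Metric topological groups defined by a norm *)

Section GroupNorm.
Context {R : realType}.

(** The single inequality on differences yields both evenness and subadditivity. *)
Definition group_norm (G : zmodType) (N : G -> R) : Prop :=
  [/\ N 0 = 0, forall x, N x = 0 -> x = 0
    & forall x y, N (x - y) <= N x + N y].

(** An alias of [G] indexed by its norm, so that the metric and the topology can be attached to it
    as instances. *)
Definition norm_group (G : zmodType) (N : G -> R) (_ : group_norm N) : Type :=
  G.

Context (G : zmodType) (N : G -> R) (nN : group_norm N).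

HB.instance Definition _ := GRing.Zmodule.on (norm_group nN).

Let N0 : N 0 = 0. Proof. by case: nN. Qed.

Lemma group_normB x y : N (x - y) <= N x + N y.
Proof. by case: nN. Qed.

Lemma group_normN x : N (- x) = N x.
Proof.
have le y : N (- y) <= N y.
  by rewrite -[- y]sub0r (le_trans (group_normB _ _))// N0 add0r.
by apply/eqP; rewrite eq_le le -{1}[x]opprK le.
Qed.

Lemma group_normD x y : N (x + y) <= N x + N y.
Proof. by rewrite -{1}[y]opprK -(group_normN y) group_normB. Qed.

Let dist (x y : norm_group nN) : R := N (x - y).

Let dist_xx x : dist x x = 0.
Proof. by rewrite /dist subrr. Qed.

Let dist_eq0 x y : dist x y = 0 -> x = y.
Proof. by have [_ h _] := nN; move=> /h/eqP; rewrite subr_eq0 => /eqP. Qed.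

Let dist_sym x y : dist x y = dist y x.
Proof. by rewrite /dist -group_normN opprB. Qed.

Let dist_triangle y x z : dist x z <= dist x y + dist y z.
Proof. by rewrite /dist -[x in leLHS](subrK y) -addrA group_normD. Qed.

HB.instance Definition _ :=
  isMetric.Build R (norm_group nN) dist_xx dist_eq0 dist_sym dist_triangle.

Lemma norm_group_ballE (x : norm_group nN) e y : ball x e y = (N (x - y) < e).
Proof. by rewrite ballEmdist. Qed.

Lemma norm_group_cvgP (T : Type) (F : set_system T) (f : T -> norm_group nN)
    (l : norm_group nN) : Filter F ->
  (f @ F --> l) <-> (forall e, 0 < e -> \forall t \near F, N (l - f t) < e).
Proof.
move=> FF; split => [/cvg_ballP fl e e0|fl].
  by apply: filterS (fl e e0) => t; rewrite norm_group_ballE.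
apply/cvg_ballP => e e0.
by apply: filterS (fl e e0) => t; rewrite norm_group_ballE.
Qed.

Let sub_continuous :
  continuous (fun x : norm_group nN * norm_group nN => x.1 - x.2).
Proof.
move=> [x y]; apply/norm_group_cvgP => e e0 /=.
have e2 : 0 < e / 2 by rewrite divr_gt0.
exists (ball x (e / 2), ball y (e / 2)); first by split; exact: nbhsx_ballx.
move=> [s t] [/=]; rewrite !norm_group_ballE => xs yt.
have -> : x - y - (s - t) = x - s - (y - t) by rewrite !opprD addrACA.
by rewrite (le_lt_trans (group_normB _ _))// (splitr e) ltrD.
Qed.

HB.instance Definition _ :=
  PreTopologicalNmodule_isTopologicalZmodule.Build (norm_group nN)
    sub_continuous.

End GroupNorm.

(** * The circle as the quotient of the reals by the integers *)

Section Circle.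
Context {R : realType}.

Definition int_closed : zmodClosed R :=
  GRing.ZmodClosed.clone R (@archimedean.Num.int_num_subdef R) _.

Definition circle0 : zmodType := Quotient.quot int_closed.

Definition proj0 (x : R) : circle0 := \pi_(circle0)%qT x.

Lemma proj0B x y : proj0 (x - y) = proj0 x - proj0 y.
Proof. exact: raddfB. Qed.

Lemma proj0_eq0 x : (proj0 x == 0) = (x \is a Num.int).
Proof.
have -> : 0 = proj0 0 by have := proj0B 0 0; rewrite !subrr => ->.
by rewrite -[in RHS](subr0 x) -(Quotient.idealrBE int_closed).
Qed.

(* The representative of [t] in [-1/2, 1/2). *)
Definition arg0 (t : circle0) : R :=
  repr t - (Num.floor (repr t + 2^-1))%:~R.

Lemma proj0_arg0 t : proj0 (arg0 t) = t.
Proof.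
rewrite /arg0 proj0B [X in _ - X](_ : _ = 0) ?subr0; first exact: reprK.
by apply/eqP; rewrite proj0_eq0 intr_int.
Qed.

Lemma arg0_itv t : - 2^-1 <= arg0 t < 2^-1.
Proof.
rewrite /arg0; set r := repr _.
have := Num.Theory.floor_itv (r + 2^-1).
by rewrite intrD => /andP[]; set f := _%:~R; lra.
Qed.

(** Any other representative differs from the chosen one by a nonzero integer, and the chosen one
    has absolute value at most 1/2. *)
Lemma arg0_proj0 x : `|arg0 (proj0 x)| <= `|x|.
Proof.
set y := arg0 _.
have /andP[yl yu] : - 2^-1 <= y < 2^-1.
  exact: arg0_itv.
have : y - x \is a Num.int.
  by rewrite -proj0_eq0 proj0B proj0_arg0 subrr.
move=> /intrP[n yx]; have -> : x = y - n%:~R by rewrite -yx opprB addrC subrK.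
have [->|n0] := eqVneq n 0; first by rewrite subr0.
have : (1 <= `|n|%:~R :> R) by rewrite ler1z -gtz0_ge1 normr_gt0.
rewrite intr_norm => n1.
have : `|y| <= 2^-1 by rewrite ler_norml yl ltW.
have := lerB_dist n%:~R y; rewrite distrC; lra.
Qed.

Definition circle_norm (t : circle0) : R := `|arg0 t|.

Lemma circle_norm_group : group_norm circle_norm.
Proof.
rewrite /circle_norm; split.
- apply/eqP; rewrite eq_le normr_ge0 andbT.
  rewrite -(subrr 0) -(proj0_arg0 0) -proj0B subrr.
  by rewrite (le_trans (arg0_proj0 _))// normr0.
- move=> t /normr0_eq0 t0; rewrite -(proj0_arg0 t) t0.
  by apply/eqP; rewrite proj0_eq0 int_num0.
- move=> s t; rewrite -{1}(proj0_arg0 s) -{1}(proj0_arg0 t) -proj0B.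
  by rewrite (le_trans (arg0_proj0 _))// ler_normB.
Qed.

Definition circle := norm_group circle_norm_group.

HB.instance Definition _ := Metric.on circle.
HB.instance Definition _ := TopologicalZmodule.on circle.

Definition circle_proj : R -> circle := proj0.
Definition circle_arg : circle -> R := arg0.

Lemma circle_proj_is_additive : zmod_morphism circle_proj.
Proof. exact: proj0B. Qed.

HB.instance Definition _ :=
  GRing.isZmodMorphism.Build R circle circle_proj circle_proj_is_additive.

End Circle.
Arguments circle R : clear implicits.

Section CircleTheory.
Context {R : realType}.
Implicit Types (s t : circle R) (x y : R).

Lemma circle_projK t : circle_proj (circle_arg t) = t.
Proof. exact: proj0_arg0. Qed.

Lemma circle_proj_eq0 x : (circle_proj x == 0) = (x \is a Num.int).
Proof. exact: proj0_eq0. Qed.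

Lemma circle_arg_proj_le x : `|circle_arg (circle_proj x)| <= `|x|.
Proof. exact: arg0_proj0. Qed.

Lemma circle_arg_proj x : `|x| < 2^-1 -> circle_arg (circle_proj x) = x.
Proof.
move=> xl; have := circle_arg_proj_le x; set y := circle_arg _ => yx.
have : y - x \is a Num.int.
  by rewrite -circle_proj_eq0 raddfB/= circle_projK subrr.
move=> /intrP[n /eqP]; rewrite subr_eq => /eqP yE.
have [n0|n0] := eqVneq n 0; first by rewrite yE n0 add0r.
have : (1 <= `|n|%:~R :> R) by rewrite ler1z -gtz0_ge1 normr_gt0.
rewrite intr_norm; have -> : n%:~R = y - x by rewrite yE addrK.
have := ler_normB y x; lra.
Qed.

Lemma circle_arg0 : circle_arg 0 = 0 :> R.
Proof. by rewrite -(raddf0 circle_proj) circle_arg_proj// normr0 invr_gt0. Qed.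

Lemma circle_arg_le t : `|circle_arg t| <= 2^-1.
Proof.
by have /andP[? /ltW ?] := arg0_itv t; rewrite ler_norml; apply/andP.
Qed.

Lemma circle_cvgP (T : Type) (F : set_system T) (f : T -> circle R) t :
  Filter F ->
  (f @ F --> t) <->
  (forall e, 0 < e -> \forall z \near F, `|circle_arg (t - f z)| < e).
Proof. by move=> FF; exact: norm_group_cvgP. Qed.

Lemma circle_proj_continuous : continuous (@circle_proj R).
Proof.
move=> x; apply/circle_cvgP => e e0.
have /cvgrPdist_lt/(_ e e0) : id y @[y --> x] --> x by exact: cvg_id.
by apply: filterS => y; apply: le_lt_trans; rewrite -raddfB circle_arg_proj_le.
Qed.

(** The only jump of [circle_arg] is at the class of 1/2. Requiring [t - s] to be closer to 0 than
    the gap between [circle_arg t] and 1/2 excludes wrap-around, so arguments subtract exactly. *)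
Lemma circle_arg_continuous t : `|circle_arg t| < 2^-1 ->
  circle_arg s @[s --> t] --> circle_arg t.
Proof.
move=> tl; apply/(@cvgrPdist_lt _ _ _ (nbhs t)) => e e0.
have r0 : 0 < Num.min e (2^-1 - `|circle_arg t|).
  by rewrite lt_min e0 subr_gt0.
have /(@circle_cvgP _ (nbhs t) id t _)/(_ _ r0) : id s @[s --> t] --> t.
  exact: cvg_id.
apply: filterS => s; rewrite lt_min => /andP[se sr].
have -> : circle_arg s = circle_arg t - circle_arg (t - s).
  rewrite -[in LHS](_ : circle_proj (circle_arg t - circle_arg (t - s)) = s).
    rewrite circle_arg_proj//.
    by rewrite (le_lt_trans (ler_normB _ _))// addrC -ltrBrDr.
  by rewrite raddfB/= !circle_projK opprB addrC subrK.
by rewrite opprB addrC subrK.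
Qed.

Lemma circle_compact : compact [set: circle R].
Proof.
suff -> : [set: circle R] = circle_proj @` `[(- 1 : R), 1].
  apply: continuous_compact; last exact: segment_compact.
  exact/continuous_subspaceT/circle_proj_continuous.
apply/seteqP; split => // t _; exists (circle_arg t); last exact: circle_projK.
by have := circle_arg_le t; rewrite /= in_itv/= ler_norml; lra.
Qed.

End CircleTheory.

(** * Limits of sums and differences in topological groups *)

Section ZmodCvg.
Context (V : topologicalZmodType) (T : Type) (F : set_system T) {FF : Filter F}.
Implicit Types (f g : T -> V) (a b : V).

Lemma cvg_zmodD f g a b :
  f @ F --> a -> g @ F --> b -> f t + g t @[t --> F] --> a + b.
Proof.
move=> fa gb.
apply: (cvg_comp (fun t => (f t, g t)) (fun z => z.1 + z.2) (cvg_pair fa gb)).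
exact: (@add_continuous V (a, b)).
Qed.

Lemma cvg_zmodB f g a b :
  f @ F --> a -> g @ F --> b -> f t - g t @[t --> F] --> a - b.
Proof.
move=> fa gb.
apply: (cvg_comp (fun t => (f t, g t)) (fun z => z.1 - z.2) (cvg_pair fa gb)).
exact: (@sub_continuous V (a, b)).
Qed.

End ZmodCvg.

(** * Lifting circle-valued maps to the reals *)

Section Lifting.
Context {R : realType}.
Implicit Types X Y : topologicalType.

(** The set where [P] holds and its complement are both open. *)
Lemma connected_locally_constant Y (P : Y -> Prop) (y0 : Y) :
  connected [set: Y] -> (forall y1, \forall y \near y1, P y <-> P y1) ->
  P y0 -> forall y, P y.
Proof.
move=> cY lP P0 y.
have oP (Q : Y -> Prop) : (forall y1, \forall y \near y1, Q y <-> Q y1) ->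
    open [set y | Q y].
  move=> lQ; rewrite openE => y1 Qy1.
  by apply: filterS (lQ y1) => z [_]; exact.
suff PT : [set y | P y] = setT by have : [set: Y] y by []; rewrite -PT.
apply: cY; first by exists y0.
- by exists [set y | P y]; [exact: oP|rewrite setTI].
- exists [set y | P y]; last by rewrite setTI.
  rewrite -openC; apply: (oP (fun y => ~ P y)) => y1.
  by apply: filterS (lP y1) => z Pz; rewrite Pz.
Qed.

(** The differences of values of [a] are integers, so by continuity [a] is locally constant. *)
Lemma lift_unique X (a : X -> R) (x0 : X) : connected [set: X] ->
  continuous a -> (forall x, circle_proj (a x) = circle_proj (a x0)) ->
  forall x, a x = a x0.
Proof.
move=> cX ca a0; apply: (connected_locally_constant (y0 := x0)) => // x1.
have /cvgrPdist_lt/(_ 1 ltr01) := ca x1.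
apply: filterS => x xx1; suff -> : a x = a x1 by [].
have : a x1 - a x \is a Num.int.
  by rewrite -circle_proj_eq0 raddfB/= !a0 subrr.
move=> /intrP[n nE]; move: xx1; rewrite nE -intr_norm -[1]/(1%:~R) ltr_int.
move=> n1; have n0 : n = 0 by lia.
by apply/eqP; rewrite eq_sym -subr_eq0 nE n0.
Qed.

(** Tube lemma: each [(x, y1)] has a product neighbourhood on which [F] stays within [e / 2] of its
    value there, and compactness of [X] merges these. *)
Lemma compact_uniform_near X Y (F : X * Y -> circle R) y1 e :
  compact [set: X] -> continuous F -> 0 < e ->
  \forall y \near y1, forall x,
    `|circle_arg (F (x, y) - F (x, y1))| < e.
Proof.
move=> /compact_near_coveringP cX cF e0.
have := cX _ (nbhs y1)
  (fun y x => `|circle_arg (F (x, y) - F (x, y1))| < e) _.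
move=> H; have : \forall y \near y1,
    [set: X] `<=` (fun x => `|circle_arg (F (x, y) - F (x, y1))| < e).
  apply: H => x _.
  have e2 : 0 < e / 2 by rewrite divr_gt0.
  have /(@circle_cvgP _ _ (nbhs (x, y1)))/(_ _ e2) := cF (x, y1).
  move=> [[A B] /= [xA yB]] AB.
  exists (A, B) => //= -[x' y'] /= [Ax' By'].
  have /= h1 := AB (x', y') (conj Ax' By').
  have /= h2 := AB (x', y1) (conj Ax' (nbhs_singleton yB)).
  have -> : F (x', y') - F (x', y1) =
      (F (x, y1) - F (x', y1)) - (F (x, y1) - F (x', y')).
    by rewrite opprB [RHS]addrC addrA subrK.
  rewrite (le_lt_trans (group_normB circle_norm_group _ _))//.
  by rewrite (splitr e) ltrD.
by apply: filterS => y h x; exact: h.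
Qed.

(* The lifts of [F (_, y)] vanishing at [x0] depend continuously on [y]: by
   compactness of [X], nearby values of [y] give uniformly close maps, whose
   difference lifts through [circle_arg]. *)
Lemma circle_lift X Y (F : X * Y -> circle R) (x0 : X) (y0 : Y) :
  compact [set: X] -> connected [set: X] -> connected [set: Y] ->
  continuous F -> (forall x, F (x, y0) = 0) -> (forall y, F (x0, y) = 0) ->
  exists2 k : X * Y -> R, continuous k & forall z, F z = circle_proj (k z).
Proof.
move=> cX kX kY cF Fx0 Fy0.
pose lift y (m : X -> R) := [/\ continuous m, m x0 = 0
  & forall x, F (x, y) = circle_proj (m x)].
have half0 : 0 < 2^-1 :> R by rewrite invr_gt0.
have cFx y : continuous (fun x => F (x, y)).
  move=> x; apply: (@continuous_comp _ _ _ (fun x => (x, y)) F); last exact: cF.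
  by apply: cvg_pair; [exact: cvg_id|exact: cvg_cst].
have lift_near y y1 m :
    (forall x, `|circle_arg (F (x, y) - F (x, y1))| < 2^-1) ->
    lift y1 m -> lift y (fun x => m x + circle_arg (F (x, y) - F (x, y1))).
  move=> yy1 [cm m0 mE]; split.
  - move=> x; apply: cvgD; first exact: cm.
    apply: (@continuous_comp _ _ _ (fun x => F (x, y) - F (x, y1))).
      exact: (cvg_zmodB (cFx y x) (cFx y1 x)).
    exact: circle_arg_continuous.
  - by rewrite m0 !Fy0 subrr circle_arg0 addr0.
  - by move=> x; rewrite raddfD/= circle_projK -mE addrC subrK.
(* By [lift_near], having a lift is a locally constant property of [y]; at [y0] the zero map is a
   lift. *)
have liftP : forall y, exists m, lift y m.
  apply: (connected_locally_constant (y0 := y0)) => //.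
    move=> y1; apply: filterS (compact_uniform_near y1 cX cF half0) => y yy1.
    split=> -[m lm]; last by eexists; exact: lift_near lm.
    eexists; apply: lift_near lm => x.
    rewrite -[X in X < _](group_normN circle_norm_group) opprB.
    exact: yy1.
  exists (fun=> 0); split => // [|x]; first exact: cst_continuous.
  by rewrite Fx0 raddf0.
have [m lm] := choice liftP.
exists (fun z => m z.2 z.1); last by move=> [x y] /=; case: (lm y).
have lift_eq y m1 m2 : lift y m1 -> lift y m2 -> m1 =1 m2.
  move=> [c1 m10 m1E] [c2 m20 m2E] x.
  have /= := @lift_unique _ (fun x => m1 x - m2 x) x0 kX _ _ x.
  rewrite m10 m20 subrr => H; apply/eqP; rewrite -subr_eq0; apply/eqP/H.
    by move=> z; apply: cvgB; [exact: c1|exact: c2].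
  by move=> z; rewrite raddfB/= -m1E -m2E subrr raddf0.
move=> [x1 y1]; apply/(@cvgrPdist_lt _ _ _ (nbhs (x1, y1))) => e e0 /=.
have e2 : 0 < Num.min (e / 2) 2^-1 by rewrite lt_min half0 andbT divr_gt0.
have e2' : 0 < e / 2 by rewrite divr_gt0.
have [c1 _ _] := lm y1.
have /cvgrPdist_lt/(_ _ e2') cx := c1 x1.
have cy := compact_uniform_near y1 cX cF e2.
eexists (_, _); first by split; [exact: cx|exact: cy].
move=> [x y] /= [xx1 yy1].
(* By uniqueness, the chosen lift at [y] is the one that [lift_near] builds from the lift at
   [y1]. *)
have -> : m y x = m y1 x + circle_arg (F (x, y) - F (x, y1)).
  apply: (lift_eq y _ (fun x => _ + circle_arg (F (x, y) - F (x, y1)))) => //.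
  apply: lift_near (lm y1) => z.
  by have := yy1 z; rewrite lt_min => /andP[].
have := yy1 x; rewrite lt_min => /andP[yx _].
rewrite opprD addrA (le_lt_trans (ler_normB _ _))// (splitr e) ltrD//.
Qed.

End Lifting.

(** * Divisibility of circle-valued maps up to homotopy *)

Lemma subrDA_cancel (V : zmodType) (a b c d : V) :
  b + (c - d) = a + b + c - (a + d).
Proof. by rewrite -[a + b + c]addrA [a + (b + c)]addrC opprD !addrA addrK. Qed.

Section Divisibility.
Context {R : realType}.

(** A map to the circle is null-homotopic exactly when it lifts to a real map [h]. The property thus
    says that the group of homotopy classes of maps to the circle, which is the first Čech
    cohomology group for compact Hausdorff [X], is divisible by [p]. *)
Definition divisible_maps (p : nat) (X : topologicalType) : Prop :=
  forall f : X -> circle R, continuous f ->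
  exists (g : X -> circle R) (h : X -> R), [/\ continuous g, continuous h
    & forall x, f x = g x *+ p + circle_proj (h x)].

Lemma homeomorphic_sym (X Y : topologicalType) :
  homeomorphic X Y -> homeomorphic Y X.
Proof. by move=> [f [g [fK gK cf cg]]]; exists g, f; split. Qed.

Lemma divisible_maps_homeo p (X Y : topologicalType) :
  homeomorphic X Y -> divisible_maps p X -> divisible_maps p Y.
Proof.
move=> [u [v [uK vK cu cv]]] dX f cf.
have cfu : continuous (f \o u).
  by move=> x; apply: continuous_comp; [exact: cu|exact: cf].
have [g [h [cg ch gh]]] := dX (f \o u) cfu.
exists (g \o v), (h \o v); split => [y|y|y].
- by apply: continuous_comp; [exact: cv|exact: cg].
- by apply: continuous_comp; [exact: cv|exact: ch].
- by rewrite /= -gh /= vK.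
Qed.

Context (G : topologicalZmodType).
Hypotheses (kG : compact [set: G]) (cG : connected [set: G]).

(** The additivity defect, corrected by [g 0], vanishes on both axes of [G * G], so [circle_lift]
    applies to it. *)
Lemma circle_map_quasi_additive (g : G -> circle R) : continuous g ->
  exists2 k : G * G -> R, continuous k &
    forall x y, g (x + y) = g x + g y - g 0 + circle_proj (k (x, y)).
Proof.
move=> cg.
pose F (z : G * G) := g (z.1 + z.2) - (g z.1 + g z.2 - g 0).
have cF : continuous F.
  move=> z.
  have c1 : g t.1 @[t --> z] --> g z.1.
    by apply: (@continuous_comp _ _ _ fst g); [exact: cvg_fst|exact: cg].
  have c2 : g t.2 @[t --> z] --> g z.2.
    by apply: (@continuous_comp _ _ _ snd g); [exact: cvg_snd|exact: cg].
  apply: cvg_zmodB; last first.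
    by apply: cvg_zmodB (cvg_cst _); exact: cvg_zmodD c1 c2.
  apply: (@continuous_comp _ _ _ (fun t : G * G => t.1 + t.2) g).
    exact: add_continuous.
  exact: cg.
have Fx0 x : F (x, 0) = 0 by rewrite /F/= addr0 addrK subrr.
have F0y y : F (0, y) = 0 by rewrite /F/= add0r addrAC subrr add0r subrr.
have [k ck kE] := circle_lift kG cG cG cF Fx0 F0y.
by exists k => // x y; rewrite -kE /F/= [RHS]addrC subrK.
Qed.

Lemma mulrn_continuous n : continuous (fun x : G => x *+ n).
Proof.
elim: n => [|n ih] x; first exact: (@cvg_cst _ (0 : G)).
rewrite (_ : (fun x : G => x *+ n.+1) = fun x => x + x *+ n); last first.
  by apply/funext => y; rewrite mulrS.
exact: cvg_zmodD cvg_id (ih x).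
Qed.

(** By induction on [n], each step adds a defect [k (x, x *+ n)]; the constant [g 0] is absorbed
    into [h] through [circle_arg]. *)
Lemma circle_map_mulrn (g : G -> circle R) n : continuous g ->
  exists2 h : G -> R, continuous h &
    forall x, g (x *+ n) = g x *+ n + circle_proj (h x).
Proof.
move=> cg; have [k ck kE] := circle_map_quasi_additive cg.
elim: n => [|n [h ch hE]].
  exists (fun=> circle_arg (g 0)) => [|x]; first exact: cst_continuous.
  by rewrite !mulr0n add0r circle_projK.
exists (fun x => h x + k (x, x *+ n) - circle_arg (g 0)) => x.
  apply: cvgB; last exact: cvg_cst.
  apply: cvgD; first exact: ch.
  apply: (@continuous_comp _ _ _ (fun x => (x, x *+ n)) k); last exact: ck.
  exact: cvg_pair cvg_id (@mulrn_continuous n x).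
rewrite mulrS kE hE raddfB raddfD/= circle_projK mulrS.
by rewrite -!addrA; do 2 congr (_ + _); congr (_ + _); rewrite addrC.
Qed.

(** Quasi-additivity leaves only the constant [g z - g 0], which [circle_arg] lifts. *)
Lemma circle_map_translation (g : G -> circle R) z : continuous g ->
  exists2 m : G -> R, continuous m &
    forall x, g (x + z) = g x + circle_proj (m x).
Proof.
move=> cg; have [k ck kE] := circle_map_quasi_additive cg.
exists (fun x => circle_arg (g z - g 0) + k (x, z)) => x.
  apply: cvgD; first exact: cvg_cst.
  apply: (@continuous_comp _ _ _ (fun x => (x, z)) k); last exact: ck.
  exact: cvg_pair cvg_id (cvg_cst _).
by rewrite kE raddfD/= circle_projK !addrA.
Qed.

(** Writing [x] as [psi x *+ p] and moving the multiple outside [f] gives [g] as [f \o psi]. *)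
Lemma divisible_maps_group p (psi : G -> G) : continuous psi ->
  (forall x, psi x *+ p = x) -> divisible_maps p G.
Proof.
move=> cpsi psiK f cf; have [h ch hE] := circle_map_mulrn p cf.
exists (f \o psi), (h \o psi); split => [x|x|x].
- by apply: continuous_comp; [exact: cpsi|exact: cf].
- by apply: continuous_comp; [exact: cpsi|exact: ch].
- by rewrite /= -hE psiK.
Qed.

(* If [chi = p g + h], then translating by [z] gives
   [chi z = p m + (h (x + z) - h x)], where [m] lifts [g (x + z) - g x], and the
   right-hand side is a real constant; summing over the orbit of [z] shows that
   this constant is the sum of [m] around a cycle, hence an integer. *)
Lemma torsion_not_divisible_maps p (chi : {additive G -> circle R}) (z : G) :
  continuous chi -> (0 < p)%N -> z *+ p = 0 -> chi z <> 0 ->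
  ~ divisible_maps p G.
Proof.
move=> cchi p0 zp chiz /(_ _ cchi)[g [h [cg ch chiE]]]; apply: chiz.
have [m cm mE] := circle_map_translation z cg.
pose a x := m x *+ p + (h (x + z) - h x).
have ca : continuous a.
  move=> x; apply: cvgD; first exact: cvgMn (cm x).
  apply: cvgB; last exact: ch.
  apply: (@continuous_comp _ _ _ (fun x => x + z) h); last exact: ch.
  exact: cvg_zmodD cvg_id (cvg_cst _).
have aE x : circle_proj (a x) = chi z.
  have -> : chi z = chi (x + z) - chi x by rewrite raddfD/= addrC addKr.
  rewrite !chiE mE mulrnDl raddfD raddfMn raddfB/=.
  exact: subrDA_cancel.
have a0 x : a x = a 0 by apply: lift_unique => // y; rewrite !aE.
pose c := \sum_(j < p) m (z *+ j).
have : a 0 *+ p = c *+ p.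
  transitivity (\sum_(j < p) a (z *+ j)).
    by under eq_bigr do rewrite a0; rewrite sumr_const card_ord.
  rewrite big_split/= -sumrMnl [X in _ + X](_ : _ = 0) ?addr0//.
  under eq_bigr do rewrite -mulrSr.
  rewrite -(big_mkord xpredT (fun j => h (z *+ j.+1) - h (z *+ j))).
  by rewrite telescope_sumr// zp mulr0n subrr.
move/eqP; rewrite eqr_pMn2r// => /eqP a0c; rewrite -(aE 0) a0c /c raddf_sum/=.
transitivity (\sum_(j < p) (g (z *+ j.+1) - g (z *+ j))).
  by apply: eq_bigr => j _; rewrite mulrSr mE addrC addKr.
rewrite -(big_mkord xpredT (fun j => g (z *+ j.+1) - g (z *+ j))).
by rewrite telescope_sumr// zp mulr0n subrr.
Qed.

End Divisibility.

(** * Solenoid powers as compact metric groups *)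

Lemma fmap_ultra (T U : Type) (f : T -> U) (F : set_system T) :
  UltraFilter F -> UltraFilter (f @ F).
Proof.
move=> UF; split; first exact: fmap_proper_filter.
move=> G GF FG; apply/seteqP; split => A; last exact: FG.
move=> GA; have [//|FnA] := in_ultra_setVsetC (f @^-1` A) UF.
by have /filter_ex[? []] : G (A `&` ~` A) by apply: filterI => //; exact: FG.
Qed.

Section Solenoid.
Context {R : realType} (P : nat_pred).
Local Notation seqs := (nat * nat -> circle R).

(* Characters of the group generated by elements [e k m] subject to
   [e k 0 = 0] and [e k m = u e k (m u)] for [P]-numbers [u]. Splitting [m] into
   its [P]-part and its [P']-part shows that this group is a countable direct
   sum of copies of Z[1/P]; letting [m] range over all naturals makes division
   by a [P]-number a mere shift of indices. *)
Definition solenoid_eqs (x : seqs) : Prop :=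
  (forall k, x (k, 0%N) = 0) /\
  (forall k m u, P.-nat u -> x (k, m) = x (k, (m * u)%N) *+ u).

Definition solenoid_pred : {pred seqs} := fun x => `[< solenoid_eqs x >].

Lemma solenoid_pred_zmod_closed : zmod_closed solenoid_pred.
Proof.
split.
  by apply/asboolP; split => [//|k m u _]; rewrite /GRing.zero/= mul0rn.
move=> x y /asboolP[x0 xE] /asboolP[y0 yE].
apply/asboolP; split => [k|k m u Pu].
  by rewrite -[LHS]/(x (k, 0%N) - y (k, 0%N)) x0 y0 subrr.
rewrite -[LHS]/(x (k, m) - y (k, m)) (xE k m u)// (yE k m u)//.
by rewrite -mulrnBl.
Qed.

HB.instance Definition _ := GRing.isZmodClosed.Build seqs solenoid_pred
  solenoid_pred_zmod_closed.

Record solenoid0 := Solenoid0 {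
  solenoid_val :> seqs; solenoid_valP : solenoid_val \in solenoid_pred }.

HB.instance Definition _ := [isSub for solenoid_val].
HB.instance Definition _ := [Choice of solenoid0 by <:].
HB.instance Definition _ := [SubChoice_isSubZmodule of solenoid0 by <:].

Lemma solenoid0P (x : solenoid0) : solenoid_eqs x.
Proof. by apply/asboolP; case: x. Qed.

Lemma solenoid0B (x y : solenoid0) i : (x - y) i = x i - y i.
Proof. by []. Qed.

(** The denominators grow with the code of the index, so that the supremum norm induces the product
    topology. *)
Definition solenoid_weight (x : solenoid0) (i : nat * nat) : R :=
  `|circle_arg (x i)| / (pickle i).+1%:R.

Definition solenoid_norm (x : solenoid0) : R := sup (range (solenoid_weight x)).

Lemma solenoid_weight_le x i : solenoid_weight x i <= (pickle i).+1%:R^-1 / 2.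
Proof.
by rewrite /solenoid_weight mulrC ler_wpM2l ?invr_ge0// circle_arg_le.
Qed.

Lemma solenoid_weight_le_arg x i : solenoid_weight x i <= `|circle_arg (x i)|.
Proof.
by rewrite /solenoid_weight ler_piMr// invf_le1 ?ltr0n// ler1n.
Qed.

Lemma solenoid_norm_ub x i : solenoid_weight x i <= solenoid_norm x.
Proof.
apply: ub_le_sup; last by exists i.
exists 2^-1 => _ [j _ <-]; rewrite (le_trans (solenoid_weight_le_arg _ _))//.
exact: circle_arg_le.
Qed.

Lemma solenoid_norm_le x e :
  (forall i, solenoid_weight x i <= e) -> solenoid_norm x <= e.
Proof.
move=> xe; apply: ge_sup.
  by exists (solenoid_weight x (0, 0)%N), (0, 0)%N.
by move=> _ [i _ <-].
Qed.

Lemma solenoid_group_norm : group_norm solenoid_norm.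
Proof.
split.
- apply/eqP; rewrite eq_le; apply/andP; split.
    apply: solenoid_norm_le => i.
    rewrite /solenoid_weight -[X in circle_arg X]/(0 : circle R).
    by rewrite circle_arg0 normr0 mul0r.
  by apply: le_trans (solenoid_norm_ub 0 (0, 0)%N); rewrite divr_ge0.
- move=> x x0; apply/val_inj/funext => i /=.
  have := solenoid_norm_ub x i.
  rewrite x0 /solenoid_weight pmulr_lle0 ?invr_gt0//.
  by rewrite normr_le0 => /eqP xi0; rewrite -(circle_projK (x i)) xi0 raddf0.
- move=> x y; apply: solenoid_norm_le => i.
  apply: le_trans (lerD (solenoid_norm_ub x i) (solenoid_norm_ub y i)).
  rewrite /solenoid_weight -mulrDl ler_wpM2r ?invr_ge0// solenoid0B.
  exact: group_normB circle_norm_group _ _.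
Qed.

Definition solenoid := norm_group solenoid_group_norm.

HB.instance Definition _ := Metric.on solenoid.
HB.instance Definition _ := TopologicalZmodule.on solenoid.

Definition scoord (i : nat * nat) (x : solenoid) : circle R :=
  (x : solenoid0) i.

Lemma scoord_is_additive i : zmod_morphism (scoord i).
Proof. by []. Qed.

HB.instance Definition _ i :=
  GRing.isZmodMorphism.Build solenoid (circle R) (scoord i)
    (scoord_is_additive i).

Lemma scoord_eq (x y : solenoid) : (forall i, scoord i x = scoord i y) -> x = y.
Proof. by move=> xy; apply/val_inj/funext. Qed.

Lemma scoord_0 k (x : solenoid) : scoord (k, 0%N) x = 0.
Proof. by case: (solenoid0P x) => + _; exact. Qed.

Lemma scoord_mulrn k m u (x : solenoid) : P.-nat u ->
  scoord (k, m) x = scoord (k, (m * u)%N) x *+ u.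
Proof. by case: (solenoid0P x) => _; exact. Qed.

Lemma solenoid_ex (x : seqs) : solenoid_eqs x ->
  {y : solenoid | forall i, scoord i y = x i}.
Proof. by move=> /asboolP xP; exists (Solenoid0 xP). Qed.

Lemma scoord_continuous i : continuous (scoord i).
Proof.
move=> x; apply/(@circle_cvgP _ _ (nbhs x)) => e e0.
have /(@norm_group_cvgP _ _ _ _ _ (nbhs x)) : id y @[y --> x] --> x.
  exact: cvg_id.
have e' : 0 < e / (pickle i).+1%:R by rewrite divr_gt0.
move=> /(_ _ e'); apply: filterS => y.
move=> /(le_lt_trans (solenoid_norm_ub _ i)).
by rewrite /solenoid_weight ltr_pM2r ?invr_gt0// solenoid0B.
Qed.

(** Indices of code at least [n] contribute less than [e / 2] by their weight alone; the finitely
    many others are controlled by coordinatewise convergence. *)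
Lemma solenoid_cvg (T : Type) (F : set_system T) (f : T -> solenoid) x :
  Filter F -> (forall i, scoord i (f t) @[t --> F] --> scoord i x) ->
  f @ F --> x.
Proof.
move=> FF fx; apply/norm_group_cvgP => e e0.
have [n ne] : exists n : nat, n.+1%:R^-1 < e.
  have [n _ H] := near_infty_natSinv_lt (PosNum e0).
  by exists n; apply: H => /=.
have near_n j : \forall t \near F, forall i, pickle i = j ->
    `|circle_arg (scoord i x - scoord i (f t))| < e / 2.
  (* At most one index has code [j], so one coordinate limit suffices. *)
  case E : (unpickle j : option (nat * nat)) => [i|]; last first.
    by apply: nearW => t i ij; move: E; rewrite -ij pickleK.
  have e2 : 0 < e / 2 by rewrite divr_gt0.
  have /circle_cvgP/(_ _ e2) := fx i.
  by apply: filterS => t ti i' ij; move: E; rewrite -ij pickleK => -[->].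
have near_lt : \forall t \near F, forall i, (pickle i < n)%N ->
    `|circle_arg (scoord i x - scoord i (f t))| < e / 2.
  elim: n {ne} => [|n ih]; first exact: nearW.
  apply: filterS2 ih (near_n n) => t t1 t2 i; rewrite ltnS leq_eqVlt.
  by case/orP => [/eqP/t2|/t1].
apply: filterS near_lt => t tn.
rewrite (@le_lt_trans _ _ (e / 2))//; last first.
  by rewrite ltr_pdivrMr// mulr_natr mulr2n ltrDl.
apply: solenoid_norm_le => i; have [/tn ti|ni] := ltnP (pickle i) n.
  by rewrite (le_trans (solenoid_weight_le_arg _ _))// ltW.
rewrite (le_trans (solenoid_weight_le _ _))// ler_pM2r ?invr_gt0//.
by rewrite (le_trans _ (ltW ne))// lef_pV2 ?posrE// ler_nat ltnS.
Qed.

Lemma solenoid_continuous (T : topologicalType) (f : T -> solenoid) :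
  (forall i, continuous (fun t => scoord i (f t))) -> continuous f.
Proof. by move=> cf t; apply: solenoid_cvg => i; exact: cf. Qed.

(** As in Tychonoff's theorem, an ultrafilter converges in each coordinate since the circle is
    compact; uniqueness of limits passes the defining equations to the limit. *)
Lemma solenoid_compact : compact [set: solenoid].
Proof.
rewrite compact_ultra => F UF _.
have cvgi i : exists l : circle R, scoord i @ F --> l.
  have := @circle_compact R; rewrite compact_ultra => /(_ (scoord i @ F)).
  move=> /(_ (fmap_ultra _ _)) [|l [_ ?]]; last by exists l.
  exact: filterT.
have [l lP] := choice cvgi.
have hT : hausdorff_space (circle R) by exact: metric_hausdorff.
have lE : solenoid_eqs l.
  split=> [k|k m u Pu].
    apply: (cvg_unique hT (lP (k, 0%N))).
    rewrite (_ : scoord (k, 0%N) = fun=> 0); last first.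
      by apply/funext => x; exact: scoord_0.
    exact: cvg_cst.
  apply: (cvg_unique hT (lP (k, m))).
  pose mu := (k, (m * u)%N).
  rewrite (_ : scoord (k, m) = fun x => scoord mu x *+ u); last first.
    by apply/funext => x; exact: scoord_mulrn.
  apply: (@cvg_comp _ _ _ (scoord mu) (fun t => t *+ u) _ (nbhs (l mu))).
    exact: lP.
  exact: mulrn_continuous.
have [x xE] := solenoid_ex lE.
exists x; split => //; apply: solenoid_cvg => i.
by rewrite xE; exact: lP.
Qed.

End Solenoid.

(** * Squares, divisibility and connectedness of solenoid powers *)

Section SolenoidTopology.
Context {R : realType} (P : nat_pred).
Local Notation sol := (@solenoid R P).

Definition solenoid_of (T : Type) (F : T -> nat * nat -> circle R)
  (eF : forall t, solenoid_eqs P (F t)) (t : T) : sol :=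
  sval (solenoid_ex (eF t)).

Lemma scoord_solenoid_of T F (eF : forall t : T, solenoid_eqs P (F t)) i t :
  scoord i (solenoid_of eF t) = F t i.
Proof. exact: (svalP (solenoid_ex (eF t))). Qed.

(** A pair is interleaved: its first member fills the even factors [k], its second the odd ones. *)
Lemma solenoid_square : homeomorphic (sol * sol)%type sol.
Proof.
pose F (z : sol * sol) (i : nat * nat) :=
  scoord (i.1./2, i.2) (if odd i.1 then z.2 else z.1).
have eF z : solenoid_eqs P (F z).
  by split => [k|k m u Pu]; [exact: scoord_0|exact: scoord_mulrn].
pose G (b : bool) (w : sol) (i : nat * nat) := scoord (b + i.1.*2, i.2)%N w.
have eG b w : solenoid_eqs P (G b w).
  by split => [k|k m u Pu]; [exact: scoord_0|exact: scoord_mulrn].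
exists (solenoid_of eF).
exists (fun w => (solenoid_of (eG false) w, solenoid_of (eG true) w)).
split.
- move=> [x y]; congr pair; apply: scoord_eq => -[k m];
    rewrite !scoord_solenoid_of /G scoord_solenoid_of /F/=.
    by rewrite add0n odd_double doubleK.
  by rewrite add0n odd_double/= uphalf_double.
- move=> w; apply: scoord_eq => -[k m]; rewrite scoord_solenoid_of /F/=.
  rewrite -[X in _ = scoord (X, _) _](odd_double_half k).
  by case: (odd k); rewrite scoord_solenoid_of.
- apply: solenoid_continuous => i z.
  under eq_fun do rewrite scoord_solenoid_of /F.
  case: ifP => _.
    apply: (@continuous_comp _ _ _ snd (scoord _)); first exact: cvg_snd.
    exact: scoord_continuous.
  apply: (@continuous_comp _ _ _ fst (scoord _)); first exact: cvg_fst.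
  exact: scoord_continuous.
- have cG b : continuous (solenoid_of (eG b)).
    apply: solenoid_continuous => i.
    under eq_fun do rewrite scoord_solenoid_of /G.
    exact: scoord_continuous.
  by move=> w; exact: (cvg_pair (@cG false w) (@cG true w)).
Qed.

(** The index shift from [m] to [m * p] inverts multiplication by [p], by the defining equation for
    [u = p]. *)
Lemma solenoid_divisible_maps p : connected [set: sol] -> prime p -> p \in P ->
  @divisible_maps R p sol.
Proof.
move=> cS pp pP; have Pp : P.-nat p by rewrite pnatE.
pose F (x : sol) (i : nat * nat) := scoord (i.1, i.2 * p)%N x.
have eF x : solenoid_eqs P (F x).
  split => [k|k m u Pu]; first exact: scoord_0.
  by rewrite /F/= mulnAC; exact: scoord_mulrn.
apply: (@divisible_maps_group _ _ _ _ _ (solenoid_of eF)) => //.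
- exact: solenoid_compact.
- apply: solenoid_continuous => i.
  under eq_fun do rewrite scoord_solenoid_of /F.
  exact: scoord_continuous.
- move=> x; apply: scoord_eq => -[k m].
  by rewrite raddfMn/= scoord_solenoid_of /F/= (scoord_mulrn k m x Pp).
Qed.

Lemma circle_proj_modn (n p : nat) : (0 < p)%N ->
  circle_proj (n%:R / p%:R) = circle_proj ((n %% p)%:R / p%:R) :> circle R.
Proof.
move=> p0; have p0' : p%:R != 0 :> R by rewrite pnatr_eq0 -lt0n.
rewrite [in LHS](divn_eq n p) natrD natrM mulrDl mulfK// raddfD/=.
suff -> : circle_proj (n %/ p)%:R = 0 :> circle R by rewrite add0r.
by apply/eqP; rewrite circle_proj_eq0 natr_int.
Qed.

(** The element of order [p] has the inverse of [m] modulo [p], divided by [p], as coordinate [m]. A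
    [P]-number [u] is invertible modulo [p], which gives the equations; coordinate 1 is the nonzero
    class of [1 / p]. *)
Lemma solenoid_not_divisible_maps p : connected [set: sol] -> prime p ->
  p \notin P -> ~ @divisible_maps R p sol.
Proof.
move=> cS pp pP; have p0 := prime_gt0 pp.
have p0' : p%:R != 0 :> R by rewrite pnatr_eq0 -lt0n.
(* The convention [0^-1 = 0] makes the coordinates at multiples of [p], including index 0,
   vanish. *)
pose inv (m : nat) : 'F_p := (m%:R : 'F_p)^-1.
have inv0 : inv 0%N = 0 by rewrite /inv mulr0n invr0.
pose a (m : nat) : nat := inv m.
pose z (i : nat * nat) : circle R := circle_proj ((a i.2)%:R / p%:R).
have ez : solenoid_eqs P z.
  split => [k|k m u Pu].
    by rewrite /z /a inv0 mul0r raddf0.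
  rewrite /z/= -raddfMn/= -[X in _ = circle_proj X]mulr_natr mulrAC -natrM.
  rewrite [RHS]circle_proj_modn//.
  do 3 congr (_ _); congr (_ _); apply/esym.
  rewrite -(val_Fp_nat pp) /a natrM natr_Zp /inv natrM invfM mulfVK//.
  apply/eqP => /(congr1 val) /=; rewrite (val_Fp_nat pp) => /eqP pu.
  by move/negP: pP; apply; rewrite -(pnatE _ pp); exact: pnat_dvd pu Pu.
have [zs zsE] := solenoid_ex ez.
pose chi := @scoord R P (0, 1)%N.
apply: (@torsion_not_divisible_maps _ sol _ _ _ chi zs) => //.
- exact: solenoid_compact.
- exact: scoord_continuous.
- apply: scoord_eq => i; rewrite raddfMn raddf0/= zsE /z -raddfMn/=.
  rewrite -[X in circle_proj X]mulr_natr mulfVK//.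
  by apply/eqP; rewrite circle_proj_eq0 natr_int.
- rewrite /= zsE /z /a /inv invr1 => /eqP; rewrite circle_proj_eq0.
  have -> : (1 : 'F_p) = 1%N :> nat.
    by rewrite (val_Fp_nat pp 1) modn_small ?prime_gt1.
  move=> /intrP[n nE]; have : 0 < (n%:~R : R) < 1.
    by rewrite -nE mul1r invr_gt0 ltr0n p0 invf_lt1 ?ltr0n// ltr1n prime_gt1.
  by rewrite -[1]/(1%:~R) ltr0z ltr_int; lia.
Qed.

Definition real_solenoid_eqs (th : nat * nat -> R) : Prop :=
  (forall k, th (k, 0%N) = 0) /\
  (forall k m u, P.-nat u -> th (k, m) = th (k, (m * u)%N) * u%:R).

(* The image of a real vector space, dense in the solenoid. *)
Definition solenoid_leaf : set sol :=
  [set x | exists2 th, real_solenoid_eqs th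
    & forall i, scoord i x = circle_proj (th i)].

(** The real equations are stable under scaling, so the leaf is a union of continuous images of
    lines, all passing through 0. *)
Lemma solenoid_leaf_connected : connected solenoid_leaf.
Proof.
have e (s : {th | real_solenoid_eqs th}) t :
    solenoid_eqs P (fun i => circle_proj (sval s i * t) : circle R).
  case: s => th /= [th0 thE]; split => [k|k m u Pu].
    by rewrite th0 mul0r raddf0.
  by rewrite (thE k m u Pu) -raddfMn/= -[in RHS]mulr_natr mulrAC.
have -> : solenoid_leaf = \bigcup_(s in [set: {th | real_solenoid_eqs th}])
    (solenoid_of (e s) @` [set: R]).
  apply/seteqP; split => [x [th thE xth]|x [[th thE] _ [t _ <-]]].
    exists (exist _ th thE) => //; exists 1 => //; apply: scoord_eq => i.
    by rewrite scoord_solenoid_of mulr1 xth.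
  exists (fun i => th i * t) => [|i]; last by rewrite scoord_solenoid_of.
  case: thE => [th0 thE]; split => [k|k m u Pu]; first by rewrite th0 mul0r.
  by rewrite (thE k m u Pu) mulrAC.
apply: bigcup_connected => [|s _].
  exists 0 => s _; exists 0 => //; apply: scoord_eq => i.
  by rewrite scoord_solenoid_of mulr0 !raddf0.
apply: connected_continuous_connected; first by apply/connected_intervalP.
apply: continuous_subspaceT; apply: solenoid_continuous => i t.
under eq_fun do rewrite scoord_solenoid_of.
apply: (@continuous_comp _ _ _ (fun t => sval s i * t)).
  exact: mulrl_continuous.
exact: circle_proj_continuous.
Qed.

(** For each [N], some leaf element agrees with [x] at all indices [m <= N]; along these
    approximations every coordinate is eventually constant. *)
Lemma solenoid_leaf_dense : closure solenoid_leaf = [set: sol].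
Proof.
apply/seteqP; split => // x _.
(* The real solution is prescribed at the index [m`_P^' * L], where [L] is a
   common multiple of the [P]-parts of all [m <= N]. *)
have approx N : exists d : sol, solenoid_leaf d /\
    forall k m, (m <= N)%N -> scoord (k, m) d = scoord (k, m) x.
  pose L := (N`!`_P)%N.
  have L0 : (0 < L)%N by exact: part_gt0.
  pose th (i : nat * nat) : R := if i.2 == 0%N then 0 else
    L%:R * circle_arg (scoord (i.1, (i.2`_P^' * L)%N) x) / (i.2`_P)%N%:R.
  have thE : real_solenoid_eqs th.
    split => [//|k m u Pu]; rewrite /th/=.
    have u0 : (0 < u)%N by case/andP: Pu.
    rewrite muln_eq0 (gtn_eqF u0) orbF.
    case: eqVneq => [|]; first by rewrite mul0r.
    rewrite -lt0n => m0; rewrite !partnM// (part_pnat_id Pu).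
    rewrite (@part_p'nat _ u) ?muln1.
      by rewrite natrM invfM mulrA mulfVK// pnatr_eq0 -lt0n.
    by rewrite pnatNK.
  have ed : solenoid_eqs P (fun i => circle_proj (th i) : circle R).
    case: thE => th0 thE; split => [k|k m u Pu]; first by rewrite th0 raddf0.
    by rewrite (thE k m u Pu) mulr_natr raddfMn.
  have [d dE] := solenoid_ex ed; exists d; split; first by exists th.
  move=> k m mN; rewrite dE /th/=; case: eqVneq => [->|].
    by rewrite raddf0 scoord_0.
  rewrite -lt0n => m0.
  have mL : (m`_P %| L)%N by rewrite partn_dvd ?fact_gt0// dvdn_fact// m0.
  have mP0 : (m`_P)%N%:R != 0 :> R by rewrite pnatr_eq0 -lt0n part_gt0.
  have Pq : P.-nat (L %/ m`_P)%N.
    by apply: (pnat_dvd (dvdn_div mL)); exact: part_pnat.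
  (* Multiplying by the quotient of [L] by the [P]-part of [m] carries [m] to the prescribed index;
     [th] contains the same factor. *)
  rewrite (scoord_mulrn k m x Pq).
  have -> : (m * (L %/ m`_P) = m`_P^' * L)%N.
    rewrite -{1}(partnC P m0) mulnC mulnA (divnK mL).
    by rewrite mulnC.
  rewrite -[in LHS](divnK mL) natrM mulrAC mulfK// mulrC mulr_natr raddfMn/=.
  by rewrite circle_projK divnK.
have [d dE] := choice approx.
have dx : d n @[n --> \oo] --> x.
  apply: solenoid_cvg => -[k m]; apply: cvg_near_cst.
  by exists m => // n /= mn; have [_ ->] := dE n.
move=> B /dx [n _ nB]; exists (d n); split; first by case: (dE n).
exact: nB (leqnn n).
Qed.

Lemma solenoid_connected : connected [set: sol].
Proof.
rewrite -solenoid_leaf_dense.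
exact/connected_closure/solenoid_leaf_connected.
Qed.

Lemma solenoid_continuum : continuum R sol.
Proof.
split; [by exists 0|exact: solenoid_compact|exact: solenoid_connected|].
by exists sol, id, id; split=> // x; exact: cvg_id.
Qed.

End SolenoidTopology.

(** * Recovering the primes, and a family of prime sets indexed by the reals *)

Lemma solenoid_homeo_inj (R : realType) (P Q : nat_pred) p :
  homeomorphic (@solenoid R P) (@solenoid R Q) -> prime p -> p \in P -> p \in Q.
Proof.
move=> PQ pp pP; apply: contraT => pQ.
have [] := solenoid_not_divisible_maps (@solenoid_connected R Q) pp pQ.
apply: divisible_maps_homeo PQ _.
exact: solenoid_divisible_maps (@solenoid_connected R P) pp pP.
Qed.

Lemma prime_seq :
  exists2 pr : nat -> nat, injective pr & forall n, prime (pr n).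
Proof.
pose next m := s2val (prime_above m).
exists (fun n => iter n.+1 next 0%N); last first.
  by move=> n; exact: s2valP' (prime_above _).
apply: (@incn_inj (fun n => iter n.+1 next 0%N)); apply: leq_mono.
by apply: homo_ltn => [|n]; [exact: ltn_trans|exact: s2valP (prime_above _)].
Qed.

(* The family is indexed by the reals.  Since homeomorphism is reflexive, the
   second clause makes the indexing injective, so the family has exactly the
   cardinality of the continuum. *)
Theorem theorem3p2 (R : realType) :
  exists X : R -> topologicalType,
    [/\ forall r : R, continuum R (X r),
        forall r s : R, r <> s -> ~ homeomorphic (X r) (X s)
      & forall r : R, homeomorphic (X r * X r)%type (X r)].
Proof.
have [pr pr_inj pr_prime] := prime_seq.
(* [P r] encodes the Dedekind cut of [r], through an injective numbering of the rationals by
   primes. *)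
pose P (r : R) : nat_pred :=
  [pred n | `[< exists2 q : rat, n = pr (pickle q) & ratr q < r >]].
exists (fun r => @solenoid R (P r)); split => [r|r s rs|r].
- exact: solenoid_continuum.
(* A rational strictly between the two reals yields a prime lying in [P s'] but not in [P r']. *)
- have sep (r' s' : R) : r' < s' ->
      ~ homeomorphic (@solenoid R (P s')) (@solenoid R (P r')).
    move=> /rat_in_itvoo[q]; rewrite in_itv/= => /andP[rq qs].
    move=> /solenoid_homeo_inj/(_ (pr_prime (pickle q))).
    have sP : pr (pickle q) \in P s' by apply/asboolP; exists q.
    move=> /(_ sP)/asboolP[q' /pr_inj/(pcan_inj pickleK)<-].
    by rewrite ltNge (ltW rq).
  have [rs'|sr|//] := ltgtP r s.
    by move=> /homeomorphic_sym; exact: sep.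
  exact: sep.
- exact: solenoid_square.
Qed.
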